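(* Let $R$ be a commutative unital ring, $\mathcal{A}$ a commutative unital $R$-algebra, and let $(\mathcal{E},[-,-],a)$ be a symmetric Leibniz pseudoalgebra over $(R,\mathcal{A})$. Denote by $\odot$ the symmetric tensor product over $\mathcal{A}$, let $$\mathrm{Inv}=\{[X,Y]\odot Z+Y\odot [X,Z]-X\odot([Y,Z]+[Z,Y]) : X,Y,Z\in\mathcal{E}\}\subset \mathcal{E}^{\odot 2},$$ and let $\langle\mathrm{Inv}\rangle$ be the $\mathcal{A}$-submodule of $\mathcal{E}^{\odot 2}$ generated by $\mathrm{Inv}$. Then the quotient $\mathcal{A}$-module $$\mathcal{R}(\mathcal{E})=\mathcal{E}^{\odot 2}/\langle\mathrm{Inv}\rangle$$ is an $\mathcal{E}$-module (a module over the Leibniz pseudoalgebra $\mathcal{E}$) with left and right actions $\tilde\mu^\ell$ and $\tilde\mu^r$ induced by $$\mu^\ell(X)(Y_1\odot Y_2)=[X,Y_1]\odot Y_2+Y_1\odot[X,Y_2]$$ and $$-\mu^r(X)(Y_1\odot Y_2)=(Y_1\circ Y_2)\odot X .$$ These data, together with the universal scalar product $$(-|-):\mathcal{E}\times\mathcal{E}\to\mathcal{R}(\mathcal{E}),\qquad (X,Y)\mapsto (X\odot Y)^{\widetilde{\ }},$$ where $(X\odot Y)^{\widetilde{\ }}$ is the class of $X\odot Y$ in $\mathcal{R}(\mathcal{E})$, define a generalized Courant pseudoalgebra $$\mathcal{C}(\mathcal{E}):=(\mathcal{E},\mathcal{R}(\mathcal{E}),[-,-],(-|-),a,\tilde\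mu^\ell,\tilde\mu^r).$$
   Context: $\mathrm{Der}\,\mathcal{A}$ is the $\mathcal{A}$-module of ($R$-linear) derivations of $\mathcal{A}$, with the commutator bracket. An anchored module over $\mathcal{A}$ is an $\mathcal{A}$-module $\mathcal{E}$ with an $\mathcal{A}$-linear map $a:\mathcal{E}\to\mathrm{Der}\,\mathcal{A}$. A (left) Leibniz bracket on an $R$-module is an $R$-bilinear bracket with $[X,[Y,Z]]=[[X,Y],Z]+[Y,[X,Z]]$; it makes the $R$-module a Leibniz $R$-algebra. The symmetrized bracket is $X\circ Y:=[X,Y]+[Y,X]$. A Leibniz pseudoalgebra over $(R,\mathcal{A})$ is an anchored module $(\mathcal{E},a)$ over $\mathcal{A}$ with a Leibniz $R$-algebra structure $[-,-]$ such that, for all $f\in\mathcal{A}$, $X,Y\in\mathcal{E}$: $[X,fY]=f[X,Y]+a(X)(f)Y$ and $a[X,Y]=[a(X),a(Y)]$. It is symmetric if, for all $f\in\mathcal{A}$, $X,Y,Z\in\mathcal{E}$: $X\circ fY-(fX)\circ Y=0$ and $[fX,Y\circ Z]-[X,Y]\circ fZ-(fY)\circ[X,Z]=0$. A module over a Leibniz $R$-algebra $(V,[-,-])$ is an $R$-module $W$ with $R$-linear left and right actions $\mu^\ell\in\mathrm{Hom}_R(V\otimes_R W,W)$, $\mu^r\in\mathrm{Hom}_R(W\otimes_R V,W)$ (written $\mu^\ell(x)(w)$, $\mu^r(x)(w)$) such that for all $x,y\in V$: $\mu^r[x,y]=\mu^r(y)\mu^r(x)+\mu^\ell(x)\mu^r(y)$,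 $\mu^r[x,y]=\mu^\ell(x)\mu^r(y)-\mu^r(y)\mu^\ell(x)$, $\mu^\ell[x,y]=\mu^\ell(x)\mu^\ell(y)-\mu^\ell(y)\mu^\ell(x)$. A module over a Leibniz pseudoalgebra $(\mathcal{E}_1,[-,-],a)$ over $(R,\mathcal{A})$ (an $\mathcal{E}_1$-module) is an $\mathcal{A}$-module $\mathcal{E}_2$ that is a module $(\mu^\ell,\mu^r)$ over the Leibniz $R$-algebra $\mathcal{E}_1$ and satisfies $\mu^\ell(X)(fY)=f\mu^\ell(X)(Y)+a(X)(f)Y$ for $f\in\mathcal{A}$, $X\in\mathcal{E}_1$, $Y\in\mathcal{E}_2$. A generalized pre-Courant pseudoalgebra is a tuple $(\mathcal{E}_1,\mathcal{E}_2,[-,-],(-|-),a,\mu^\ell,\mu^r)$, where $(\mathcal{E}_1,[-,-],a)$ is a Leibniz pseudoalgebra over $(R,\mathcal{A})$, $(\mathcal{E}_2,\mu^\ell,\mu^r)$ is an $\mathcal{E}_1$-module, and $(-|-):\mathcal{E}_1\times\mathcal{E}_1\to\mathcal{E}_2$ is a symmetric $\mathcal{A}$-bilinear map such that for all $X,Y,Z\in\mathcal{E}_1$: $\mu^\ell(X)(Y|Z)=([X,Y]|Z)+(Y|[X,Z])$; $-\mu^r(X)(Y|Z)=([Y,Z]+[Z,Y]|X)$; and $([X,Y]|Z)+(Y|[X,Z])=([Y,Z]+[Z,Y]|X)$. A generalized Courant pseudoalgebra is a generalized pre-Courant pseudoalgebra whose underlying Leibniz pseudoalgebra $(\mathcal{E}_1,[-,-],a)$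 is symmetric. *)

(* Defs.v *)
From HB Require Import structures.
From mathcomp Require Import all_boot all_algebra.
From mathcomp Require Import generic_quotient ring_quotient.
From mathcomp Require Import boolp classical_sets functions cardinality.

Set Implicit Arguments.
Unset Strict Implicit.
Unset Printing Implicit Defensive.

Import GRing.Theory.
Local Open Scope classical_set_scope.
Local Open Scope ring_scope.

(* All base rings are [comPzRingType]s, so the zero ring is allowed.  As
   [comAlgType] requires a nonzero carrier, a commutative R-algebra A is given
   by its structure morphism [iota : {rmorphism R -> A}]. *)

Section BilinearMaps.
Variables (R : pzRingType) (U V W : lmodType R).

(* [bilinear] of sesquilinear.v is restricted to nonzero rings. *)
Definition bilin (f : U -> V -> W) : Prop :=
  (forall u, linear (f u)) /\ (forall v, linear (f^~ v)).

End BilinearMaps.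

(* M as an R-module; [iota] only selects the R-module structure. *)
Definition res_scalars (R A : comPzRingType) (iota : {rmorphism R -> A})
  (M : lmodType A) : Type := M.

Section RestrictScalars.
Variables (R A : comPzRingType) (iota : {rmorphism R -> A}) (M : lmodType A).

HB.instance Definition _ := GRing.Zmodule.on (res_scalars iota M).

Definition res_scale (r : R) (x : res_scalars iota M) : res_scalars iota M :=
  iota r *: (x : M).

Fact res_scaleA r s x :
  res_scale r (res_scale s x) = res_scale (r * s) x.
Proof. by rewrite /res_scale scalerA rmorphM. Qed.

Fact res_scale1 : left_id 1 res_scale.
Proof. by move=> x; rewrite /res_scale rmorph1 scale1r. Qed.

Fact res_scaleDr : right_distributive res_scale +%R.
Proof. by move=> r x y; rewrite /res_scale scalerDr. Qed.

Fact res_scaleDl x :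
  {morph res_scale^~ x : r s / r + s >-> r + s}.
Proof. by move=> r s; rewrite /res_scale rmorphD scalerDl. Qed.

HB.instance Definition _ := GRing.Zmodule_isLmodule.Build R (res_scalars iota M)
  res_scaleA res_scale1 res_scaleDr res_scaleDl.

End RestrictScalars.

Section Span.
Variables (A : pzRingType) (V : lmodType A) (P : set V).

Definition span : {pred V} :=
  fun v => `[< forall W : {pred V}, submod_closed W ->
                 (forall u, P u -> u \in W) -> v \in W >].

Fact span_submod_closed : submod_closed span.
Proof.
split=> [|c u v /asboolP uP /asboolP vP]; apply/asboolP => W Wsub PW.
  exact: Wsub.1.
by apply: Wsub.2; [exact: uP | exact: vP].
Qed.

HB.instance Definition _ :=
  GRing.isSubmodClosed.Build A V span span_submod_closed.

End Span.

Section QuotientModule.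
Local Open Scope quotient_scope.
Variables (A : pzRingType) (V : lmodType A) (P : set V).

(* V / <P> *)
Definition quotmod : Type := Quotient.quot (span P).

HB.instance Definition _ := Choice.on quotmod.
HB.instance Definition _ := GRing.Zmodule.on quotmod.

Definition cls (v : V) : quotmod := \pi_(Quotient.quot (span P)) v.

Lemma clsP u v : reflect (cls u = cls v) (u - v \in span P).
Proof. by rewrite Quotient.idealrBE; apply/eqP. Qed.

Fact cls_additive : {morph cls : u v / u + v}.
Proof. by move=> u v; rewrite /cls !piE. Qed.

Fact clsK (x : quotmod) : cls (repr (x : Quotient.quot (span P))) = x.
Proof. exact: reprK. Qed.

Definition quotmod_scale (c : A) (x : quotmod) : quotmod :=
  cls (c *: repr (x : Quotient.quot (span P))).

Fact quotmod_scaleE c v : quotmod_scale c (cls v) = cls (c *: v).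
Proof.
by apply/clsP; rewrite -scalerBr rpredZ //; apply/clsP; rewrite clsK.
Qed.

Fact quotmod_scaleA a b x :
  quotmod_scale a (quotmod_scale b x) = quotmod_scale (a * b) x.
Proof. by rewrite -[x]clsK !quotmod_scaleE scalerA. Qed.

Fact quotmod_scale1 : left_id 1 quotmod_scale.
Proof. by move=> x; rewrite -[x]clsK quotmod_scaleE scale1r. Qed.

Fact quotmod_scaleDr : right_distributive quotmod_scale +%R.
Proof.
move=> c x y; rewrite -[x]clsK -[y]clsK -cls_additive !quotmod_scaleE.
by rewrite scalerDr cls_additive.
Qed.

Fact quotmod_scaleDl x :
  {morph quotmod_scale^~ x : a b / a + b >-> a + b}.
Proof.
by move=> a b; rewrite -[x]clsK !quotmod_scaleE scalerDl cls_additive.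
Qed.

HB.instance Definition _ := GRing.Zmodule_isLmodule.Build A quotmod
  quotmod_scaleA quotmod_scale1 quotmod_scaleDr quotmod_scaleDl.

End QuotientModule.

Section FreeModule.
Variables (A : pzRingType) (K : choiceType).

Definition finsupp_pred : {pred K -> A^o} :=
  fun u => `[< finite_set [set k | u k != 0] >].

Fact finsupp_submod_closed : submod_closed finsupp_pred.
Proof.
split=> [|c u v /asboolP uP /asboolP vP]; apply/asboolP.
  by apply: (sub_finite_set _ (finite_set0 _)) => k /=; rewrite eqxx.
have uvP : finite_set ([set k | u k != 0] `|` [set k | v k != 0]).
  by rewrite finite_setU.
apply: (sub_finite_set _ uvP) => k /= uvk.
have [uk0|] := eqVneq (u k) 0; last by left.
right; apply: contra_neq uvk => vk0.
by rewrite [LHS](_ : _ = c *: u k + v k)// uk0 vk0 scaler0 addr0.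
Qed.

HB.instance Definition _ := GRing.isSubmodClosed.Build A (K -> A^o)
  finsupp_pred finsupp_submod_closed.

Record free_mod : Type := FreeMod {
  free_coef :> K -> A^o;
  free_coefP : free_coef \in finsupp_pred
}.

HB.instance Definition _ := [isSub for free_coef].
HB.instance Definition _ := [Choice of free_mod by <:].
HB.instance Definition _ := [SubChoice_isSubLmodule of free_mod by <:].

Fact delta_finsupp (k : K) :
  ((fun l => (k == l)%:R) : K -> A^o) \in finsupp_pred.
Proof.
apply/asboolP; apply: (sub_finite_set _ (finite_set1 k)) => l /=.
by have [->|_] := eqVneq k l; rewrite ?eqxx.
Qed.

Definition delta (k : K) : free_mod := FreeMod (delta_finsupp k).

End FreeModule.

(* The symmetric tensor square over A, presented in one step: the free module
   on E * E modulo the relations making (X, Y) |-> X ⊙ Y A-bilinear and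
   symmetric. *)
Section SymmetricSquare.
Variables (A : comPzRingType) (E : lmodType A).

Local Notation "X |* Y" := (@delta A (E * E)%type (X, Y)) (at level 40).

Definition sym2_rel : set (free_mod A (E * E)%type) :=
  [set u | exists f X X' Y,
             u = (f *: X + X') |* Y - (f *: (X |* Y) + X' |* Y)] `|`
  [set u | exists f X Y Y',
             u = X |* (f *: Y + Y') - (f *: (X |* Y) + X |* Y')] `|`
  [set u | exists X Y, u = X |* Y - Y |* X].

Definition sym2 : lmodType A := quotmod sym2_rel.

Definition odot (X Y : E) : sym2 := cls sym2_rel (X |* Y).

End SymmetricSquare.

Notation "X ⊙ Y" := (odot X Y) (at level 40, left associativity).

Section Derivations.
Variables (R A : comPzRingType) (iota : {rmorphism R -> A}).

Definition is_derivation (D : A -> A) : Prop :=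
  (forall r f g, D (iota r * f + g) = iota r * D f + D g) /\
  (forall f g, D (f * g) = D f * g + f * D g).

Definition der_pred : {pred A -> A^o} := fun D => `[< is_derivation D >].

Fact der_submod_closed : submod_closed der_pred.
Proof.
split=> [|c D1 D2 /asboolP[l1 p1] /asboolP[l2 p2]]; apply/asboolP.
  by split=> *; rewrite /= ?mulr0 ?mul0r addr0.
have DE f : (c *: D1 + D2) f = c * D1 f + D2 f by [].
split=> [r f g|f g]; rewrite !DE.
  by rewrite l1 l2 !mulrDr addrACA mulrCA.
rewrite p1 p2 !mulrDr !mulrDl addrACA mulrA; congr (_ + (_ + _)).
by rewrite mulrCA.
Qed.

HB.instance Definition _ := GRing.isSubmodClosed.Build A (A -> A^o)
  der_pred der_submod_closed.

Record Der : Type := MkDer {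
  der_fun :> A -> A^o;
  derP : der_fun \in der_pred
}.

HB.instance Definition _ := [isSub for der_fun].
HB.instance Definition _ := [Choice of Der by <:].
HB.instance Definition _ := [SubChoice_isSubLmodule of Der by <:].

Fact commutator_der (D1 D2 : Der) :
  ((fun f => D1 (D2 f) - D2 (D1 f)) : A -> A^o) \in der_pred.
Proof.
case: D1 D2 => [D1 /= /asboolP[l1 p1]] [D2 /= /asboolP[l2 p2]].
have D1D f g : D1 (f + g) = D1 f + D1 g.
  by have := l1 1 f g; rewrite !rmorph1 !mul1r.
have D2D f g : D2 (f + g) = D2 f + D2 g.
  by have := l2 1 f g; rewrite !rmorph1 !mul1r.
apply/asboolP; split=> [r f g|f g].
  by rewrite l1 l2 l1 l2 mulrBr opprD addrACA.
rewrite p1 p2 D1D D2D !p1 !p2 mulrBl mulrBr.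
set x1 := D1 (D2 f) * g; set x2 := D2 f * D1 g; set x3 := D1 f * D2 g.
set x4 := f * D1 (D2 g); set y1 := D2 (D1 f) * g; set y4 := f * D2 (D1 g).
rewrite [x3 + x4]addrC [x2 + y4]addrC.
rewrite (addrACA x1 x2) (addrACA y1 x3) [x3 + x2]addrC.
by rewrite opprD [LHS]addrACA subrr addr0 opprD [LHS]addrACA.
Qed.

Definition der_bracket (D1 D2 : Der) : Der := MkDer (commutator_der D1 D2).

End Derivations.

Section LeibnizAlgebras.
Variables (R : comPzRingType) (V : lmodType R) (br : V -> V -> V).

Record is_leibniz_algebra : Prop := {
  leibniz_bilinear : bilin br;
  leibniz_identity : forall X Y Z,
    br X (br Y Z) = br (br X Y) Z + br Y (br X Z)
}.

(* [mul x w] is mu^l(x)(w) and [mur x w] is mu^r(x)(w): the algebra element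
   comes first in both actions. *)
Record is_leibniz_module (W : lmodType R) (mul mur : V -> W -> W) : Prop := {
  lmul_bilinear : bilin mul;
  rmul_bilinear : bilin mur;
  leibniz_module_rlr : forall x y w,
    mur (br x y) w = mur y (mur x w) + mul x (mur y w);
  leibniz_module_lrr : forall x y w,
    mur (br x y) w = mul x (mur y w) - mur y (mul x w);
  leibniz_module_ll : forall x y w,
    mul (br x y) w = mul x (mul y w) - mul y (mul x w)
}.

End LeibnizAlgebras.

Section SymmetrizedBracket.
Variables (V : zmodType) (br : V -> V -> V).

Definition symbr (X Y : V) : V := br X Y + br Y X.

End SymmetrizedBracket.

Section Pseudoalgebras.
Variables (R A : comPzRingType) (iota : {rmorphism R -> A}).

Section Leibniz.
Variables (E : lmodType A) (br : E -> E -> E) (a : {linear E -> Der iota}).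

Record is_leibniz_pseudoalgebra : Prop := {
  pseudo_leibniz : @is_leibniz_algebra R (res_scalars iota E) br;
  pseudo_anchor : forall X f Y, br X (f *: Y) = f *: br X Y + a X f *: Y;
  pseudo_anchor_morph : forall X Y, a (br X Y) = der_bracket (a X) (a Y)
}.

Record is_symmetric_bracket : Prop := {
  symmetric_scale : forall f X Y,
    symbr br X (f *: Y) - symbr br (f *: X) Y = 0;
  symmetric_invariance : forall f X Y Z,
    br (f *: X) (symbr br Y Z) - symbr br (br X Y) (f *: Z)
      - symbr br (f *: Y) (br X Z) = 0
}.

Record is_symmetric_leibniz_pseudoalgebra : Prop := {
  symmetric_pseudoalgebra : is_leibniz_pseudoalgebra;
  symmetric_pseudo_bracket : is_symmetric_bracket
}.

Record is_pseudoalgebra_module (E2 : lmodType A) (mul mur : E -> E2 -> E2) :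
    Prop := {
  pseudo_module_leibniz :
    @is_leibniz_module R (res_scalars iota E) br (res_scalars iota E2) mul mur;
  pseudo_module_anchor : forall X f Y,
    mul X (f *: Y) = f *: mul X Y + a X f *: Y
}.

End Leibniz.

Section Courant.
Variables (E1 E2 : lmodType A) (br : E1 -> E1 -> E1) (sp : E1 -> E1 -> E2).
Variables (a : {linear E1 -> Der iota}) (mul mur : E1 -> E2 -> E2).

Record is_generalized_pre_courant : Prop := {
  courant_pseudoalgebra : is_leibniz_pseudoalgebra br a;
  courant_module : is_pseudoalgebra_module br a mul mur;
  courant_sp_sym : commutative sp;
  courant_sp_bilin : bilin sp;
  courant_lmul : forall X Y Z,
    mul X (sp Y Z) = sp (br X Y) Z + sp Y (br X Z);
  courant_rmul : forall X Y Z, - mur X (sp Y Z) = sp (br Y Z + br Z Y) X;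
  courant_invariance : forall X Y Z,
    sp (br X Y) Z + sp Y (br X Z) = sp (br Y Z + br Z Y) X
}.

Record is_generalized_courant : Prop := {
  courant_pre : is_generalized_pre_courant;
  courant_symmetric : is_symmetric_leibniz_pseudoalgebra br a
}.

End Courant.

End Pseudoalgebras.

Section UniversalScalarProduct.
Variables (A : comPzRingType) (E : lmodType A) (br : E -> E -> E).

Definition Inv_set : set (sym2 E) :=
  [set u | exists X Y Z,
     u = br X Y ⊙ Z + Y ⊙ br X Z - X ⊙ (br Y Z + br Z Y)].

Definition RE : lmodType A := quotmod Inv_set.

Definition RE_cls (u : sym2 E) : RE := cls Inv_set u.

Definition univ_sp (X Y : E) : RE := RE_cls (X ⊙ Y).

End UniversalScalarProduct.

(* Main.v *)
Require Import Defs.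
From HB Require Import structures.
From mathcomp Require Import all_boot all_algebra.
From mathcomp Require Import ssrAC finmap.
From mathcomp Require Import generic_quotient.
From mathcomp Require Import boolp classical_sets functions cardinality.
From mathcomp Require Import fsbigop.

Set Implicit Arguments.
Unset Strict Implicit.
Unset Printing Implicit Defensive.

Import GRing.Theory.
Local Open Scope ring_scope.

(** The two actions on the symmetric square are not A-linear: the left one obeys
    a Leibniz rule involving the anchor, and the right one sends
    [f *: (Y ⊙ Z)] to [- (fY ∘ Z) ⊙ X], where [f] stays inside the bracket.
    They are nevertheless additive, so the universal properties below are
    those of abelian groups.  As an abelian group, [sym2 E] is universal for
    biadditive symmetric maps [b] that are balanced, [b X (fY) = b (fX) Y]
    ([sym2_liftE]).  The formula for [mul] is balanced because the two anchor
    terms [a X f *: (Y ⊙ Z)] agree, and the one for [mur] because of the first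
    symmetry axiom.

    For the passage to the quotient by Inv, write [L_X] for the left action,
    [s] for the additive map [Y ⊙ Z |-> Y ∘ Z] ([sym_contract]), and
    [I(X,Y,Z) = L_X (Y ⊙ Z) - X ⊙ (Y ∘ Z)].  An additive map descends as soon
    as it sends every A-multiple of a relator to zero.
    - Since [[W,-]] is a derivation of the bracket, [L_W I(X,Y,Z)] is a sum of
      three elements of Inv ([sym2_mul_inv]), and the Leibniz rule for [L_W]
      then deals with the multiples of [I(X,Y,Z)].
    - For the right action, [s (f I(X,Y,Z)) =
      [X,Y] ∘ fZ + fY ∘ [X,Z] - fX ∘ (Y ∘ Z)].  By the second symmetry axiom
      the first two terms add up to [[fX, Y ∘ Z]], so [- [Y ∘ Z, fX]] remains,
      and it vanishes because symmetrized brackets act trivially from the left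
      in any left Leibniz algebra ([br_symbr0]).  Hence [s] kills the whole
      submodule generated by Inv ([sym_contract_Inv]).

    The module axioms hold in the symmetric square already.  They are checked
    once, on any module additively generated by the values of a bilinear map
    on which the actions have the prescribed form ([generated_module]); this
    applies to [sym2 E] with [⊙] and to [RE br] with the universal scalar
    product.  The last compatibility condition of a generalized pre-Courant
    pseudoalgebra is the vanishing of Inv in the quotient. *)

(** * Additive maps *)

Section AdditiveMaps.
Variables (U V : zmodType) (f : U -> V).
Hypothesis fD : {morph f : u v / u + v}.

Lemma morphD0 : f 0 = 0.
Proof. by apply: (addrI (f 0)); rewrite -fD !addr0. Qed.

Lemma morphDN u : f (- u) = - f u.
Proof. by apply: (addrI (f u)); rewrite -fD !subrr morphD0. Qed.

Lemma morphDB u v : f (u - v) = f u - f v.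
Proof. by rewrite fD morphDN. Qed.

Lemma morphD_sum (I : Type) (s : seq I) (F : I -> U) :
  f (\sum_(i <- s) F i) = \sum_(i <- s) f (F i).
Proof. exact: (big_morph f fD morphD0). Qed.

End AdditiveMaps.

(** * Quotient modules *)

Lemma clsZ (A : pzRingType) (V : lmodType A) (P : set V) c v :
  cls P (c *: v) = c *: cls P v.
Proof. by rewrite -quotmod_scaleE. Qed.

Lemma quotmod_ind (A : pzRingType) (V : lmodType A) (P : set V)
    (Q : quotmod P -> Prop) :
  (forall v, Q (cls P v)) -> forall x, Q x.
Proof. by move=> Qcls x; rewrite -[x]clsK. Qed.

Section QuotientLift.
Variables (A : pzRingType) (V : lmodType A) (P : set V) (G : zmodType).
Variable f : V -> G.
Hypothesis fD : {morph f : u v / u + v}.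
Hypothesis fP : forall c u, P u -> f (c *: u) = 0.

(** A map that is only additive may kill [P] without killing its span; the
    vectors all of whose multiples are killed, however, form a submodule. *)
Lemma additive_span0 u : u \in Defs.span P -> f u = 0.
Proof.
move=> /asboolP uP.
have /asboolP/(_ 1) : u \in (fun v => `[< forall c, f (c *: v) = 0 >] : bool).
  apply: uP => [|v Pv]; last by apply/asboolP => c; exact: fP.
  split=> [|b v w /asboolP fv /asboolP fw]; apply/asboolP => c.
    by rewrite scaler0 (morphD0 fD).
  by rewrite scalerDr scalerA fD fv fw addr0.
by rewrite scale1r.
Qed.

Definition quot_lift (x : quotmod P) : G :=
  f (repr (x : Quotient.quot (Defs.span P))).

Lemma quot_liftE v : quot_lift (cls P v) = f v.
Proof.
apply/eqP; rewrite -subr_eq0 -(morphDB fD); apply/eqP.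
by apply: additive_span0; apply/clsP; rewrite clsK.
Qed.

Lemma quot_liftD : {morph quot_lift : x y / x + y}.
Proof.
move=> x y; rewrite -[x]clsK -[y]clsK -cls_additive !quot_liftE.
by rewrite fD.
Qed.

End QuotientLift.

(** * Free modules *)

Section FreeModuleLift.
Variables (A : pzRingType) (K : choiceType).

Definition free_supp (u : free_mod A K) : {fset K} :=
  fset_set [set k | u k != 0]%classic.

Lemma free_suppP (u : free_mod A K) k : k \notin free_supp u -> u k = 0.
Proof.
have /asboolP ufin := free_coefP u.
by rewrite in_fset_set// notin_setE /= => /negP; rewrite negbK => /eqP.
Qed.

Lemma free_modE (u : free_mod A K) :
  u = \sum_(k <- free_supp u) (u k : A) *: delta A k.
Proof.
apply: val_inj; apply: funext => l /=.
have evD : {morph (fun v : free_mod A K => (v : K -> A^o) l) : v w / v + w}.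
  by [].
rewrite (morphD_sum evD) /=.
have evE k : ((u k : A) *: delta A k : free_mod A K) l = u k * (k == l)%:R by [].
rewrite (eq_bigr _ (fun k _ => evE k)).
have [lu|lu] := boolP (l \in free_supp u).
  rewrite (bigD1_seq l) //= eqxx mulr1 big1 ?addr0 // => k /negPf->.
  by rewrite mulr0.
rewrite big_seq big1 ?free_suppP // => k ku.
by have [kl|] := eqVneq k l; rewrite ?mulr0 //; rewrite kl (negPf lu) in ku.
Qed.

Variables (G : zmodType) (phi : K -> A -> G).
Hypothesis phiD : forall k, {morph phi k : c d / c + d}.

(** The additive extension of a family of additive maps, one for each copy of
    [A] in the free module. *)
Definition free_lift (u : free_mod A K) : G :=
  \sum_(k \in [set: K]) phi k (u k).

Lemma free_lift_seq (B : {fset K}) (u : free_mod A K) :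
  (forall k, k \notin B -> u k = 0) -> free_lift u = \sum_(k <- B) phi k (u k).
Proof.
by move=> uB; apply: fsbigTE => k /uB->; exact: morphD0 (phiD k).
Qed.

Lemma free_liftD : {morph free_lift : u v / u + v}.
Proof.
move=> u v; set B := (free_supp u `|` free_supp v)%fset.
have uB k : k \notin B -> u k = 0.
  by rewrite inE negb_or => /andP[/free_suppP].
have vB k : k \notin B -> v k = 0.
  by rewrite inE negb_or => /andP[_ /free_suppP].
have uvE k : (u + v) k = u k + v k by [].
rewrite !(@free_lift_seq B) // => [|k kB]; last by rewrite uvE uB ?vB ?addr0.
by rewrite -big_split; apply: eq_bigr => k _; rewrite uvE phiD.
Qed.

Lemma free_lift_delta c k : free_lift (c *: delta A k) = phi k c.
Proof.
have cE l : (c *: delta A k : free_mod A K) l = c * (k == l)%:R by [].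
rewrite (@free_lift_seq [fset k]%fset) => [|l].
  by rewrite big_seq_fset1 cE eqxx mulr1.
by rewrite inE cE eq_sym => /negPf->; rewrite mulr0.
Qed.

End FreeModuleLift.

(** * The symmetric square as an abelian group *)

Section SymmetricSquareLift.
Variables (A : comPzRingType) (E : lmodType A).
Implicit Types X Y Z : E.

Lemma odotC X Y : X ⊙ Y = Y ⊙ X.
Proof.
apply/clsP/asboolP => W _ PW; apply: PW; right; by exists X, Y.
Qed.

Lemma odot_linearr X : linear (fun Y : E => X ⊙ Y).
Proof.
move=> f Y Y'; rewrite /odot -clsZ -cls_additive.
by apply/clsP/asboolP => W _ PW; apply: PW; left; right; exists f, X, Y, Y'.
Qed.

Lemma odot_linearl Y : linear (fun X : E => X ⊙ Y).
Proof. by move=> f X X'; rewrite ![_ ⊙ Y]odotC odot_linearr. Qed.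

Lemma odotDr X : {morph (fun Y : E => X ⊙ Y) : Y Z / Y + Z}.
Proof. by move=> Y Z; have := odot_linearr X 1 Y Z; rewrite !scale1r. Qed.

Lemma odotDl Y : {morph (fun X : E => X ⊙ Y) : X Z / X + Z}.
Proof. by move=> X Z; rewrite ![_ ⊙ Y]odotC odotDr. Qed.

Lemma odotZr f X Y : X ⊙ (f *: Y) = f *: (X ⊙ Y).
Proof.
by have := odot_linearr X f Y 0; rewrite /= (morphD0 (odotDr X)) !addr0.
Qed.

Lemma odotZl f X Y : (f *: X) ⊙ Y = f *: (X ⊙ Y).
Proof. by rewrite ![_ ⊙ Y]odotC odotZr. Qed.

(** Additive generation suffices, without scalars, because a scalar can be
    absorbed into the first factor. *)
Lemma sym2_ind (Q : sym2 E -> Prop) :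
  (forall u v, Q u -> Q v -> Q (u + v)) -> (forall X Y, Q (X ⊙ Y)) ->
  forall u, Q u.
Proof.
move=> QD Qodot u; rewrite -[u]clsK; move: (repr _) => w; rewrite [w]free_modE.
rewrite (morphD_sum (@cls_additive _ _ _)); apply: (big_ind Q) => //.
  (* the empty sum is [0 ⊙ 0] *)
  by rewrite -(morphD0 (odotDr 0)).
by case=> X Y _; rewrite clsZ -[cls _ _]/(X ⊙ Y) -odotZl.
Qed.

Section Lift.
Variables (G : zmodType) (b : E -> E -> G).
Hypothesis bDr : forall X, {morph b X : Y Z / Y + Z}.
Hypothesis bC : commutative b.
Hypothesis b_balanced : forall f X Y, b X (f *: Y) = b (f *: X) Y.

Let bDl Y : {morph b^~ Y : X Z / X + Z}.
Proof. by move=> X Z; rewrite ![b _ Y]bC bDr. Qed.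

Let phi (k : E * E) (c : A) : G := b (c *: k.1) k.2.

Let phiD k : {morph phi k : c d / c + d}.
Proof. by move=> c d; rewrite /phi scalerDl bDl. Qed.

Definition sym2_lift : sym2 E -> G := @quot_lift _ _ (@sym2_rel A E) _ (free_lift phi).

Let sym2_rel0 c u :
  sym2_rel u -> free_lift phi (c *: u) = 0.
Proof.
have lB := morphDB (free_liftD phiD).
have lD := free_liftD phiD.
have lE := free_lift_delta phiD.
case=> [[[f [X [X' [Y ->]]]]|[f [X [Y [Y' ->]]]]]|[X [Y ->]]];
  rewrite scalerBr ?scalerDr ?scalerA lB ?lD !lE /phi /=; apply/eqP;
  rewrite subr_eq0; apply/eqP.
- by rewrite scalerDr bDl scalerA.
- by rewrite bDr b_balanced scalerA mulrC.
- by rewrite -b_balanced bC.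
Qed.

Lemma sym2_liftD : {morph sym2_lift : u v / u + v}.
Proof.
by apply: quot_liftD; [exact: free_liftD phiD | exact: sym2_rel0].
Qed.

Lemma sym2_liftE X Y : sym2_lift (X ⊙ Y) = b X Y.
Proof.
rewrite /sym2_lift /odot quot_liftE; [|exact: free_liftD phiD|exact: sym2_rel0].
by rewrite -[delta _ _]scale1r (free_lift_delta phiD) /phi scale1r.
Qed.

End Lift.
End SymmetricSquareLift.

(** * The module axioms on a module generated by products *)

Section GeneratedModule.
Variables (R A : comPzRingType) (iota : {rmorphism R -> A}).
Variables (E : lmodType A) (br : E -> E -> E) (a : {linear E -> Der iota}).
Hypothesis hE : is_leibniz_pseudoalgebra br a.
Implicit Types X Y Z : E.

Lemma brDr X : {morph br X : Y Z / Y + Z}.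
Proof.
have [linr _] := leibniz_bilinear (pseudo_leibniz hE).
by move=> Y Z; have := linr X 1 Y Z; rewrite !scale1r.
Qed.

Lemma brDl Y : {morph br^~ Y : X Z / X + Z}.
Proof.
have [_ linl] := leibniz_bilinear (pseudo_leibniz hE).
by move=> X Z; have := linl Y 1 X Z; rewrite !scale1r.
Qed.

Lemma br_iotar r X Y : br X (iota r *: Y) = iota r *: br X Y.
Proof.
have [linr _] := leibniz_bilinear (pseudo_leibniz hE).
have : br X (iota r *: Y + 0) = iota r *: br X Y + br X 0 := linr X r Y 0.
by rewrite (morphD0 (brDr X)) !addr0.
Qed.

Lemma br_iotal r X Y : br (iota r *: X) Y = iota r *: br X Y.
Proof.
have [_ linl] := leibniz_bilinear (pseudo_leibniz hE).
have : br (iota r *: X + 0) Y = iota r *: br X Y + br 0 Y := linl Y r X 0.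
by rewrite (morphD0 (brDl Y)) !addr0.
Qed.

Lemma brA X Y Z : br X (br Y Z) = br (br X Y) Z + br Y (br X Z).
Proof. exact: (leibniz_identity (pseudo_leibniz hE)). Qed.

(** Adding the Leibniz identities for [[Y,[Z,X]]] and [[Z,[Y,X]]], the double
    brackets on the two sides cancel. *)
Lemma br_symbr0 X Y Z : br (symbr br Y Z) X = 0.
Proof.
apply: (addIr (br Z (br Y X) + br Y (br Z X))); rewrite add0r.
by rewrite brDl addrACA -!brA addrC.
Qed.

Lemma br_symbr X Y Z :
  br X (symbr br Y Z) = symbr br (br X Y) Z + symbr br Y (br X Z).
Proof.
by rewrite brDr (brA X Y) (brA X Z) [br (br X Z) Y + _]addrC addrACA.
Qed.

Variables (M : lmodType A) (p : E -> E -> M).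
Hypothesis pDl : forall Y, {morph p^~ Y : X Z / X + Z}.
Hypothesis pDr : forall X, {morph p X : Y Z / Y + Z}.
Hypothesis pZl : forall f X Y, p (f *: X) Y = f *: p X Y.
Hypothesis pZr : forall f X Y, p X (f *: Y) = f *: p X Y.
Hypothesis p_ind : forall Q : M -> Prop,
  (forall u v, Q u -> Q v -> Q (u + v)) -> (forall X Y, Q (p X Y)) ->
  forall u, Q u.

Variables mul mur : E -> M -> M.
Hypothesis mulD : forall X, {morph mul X : u v / u + v}.
Hypothesis murD : forall X, {morph mur X : u v / u + v}.
Hypothesis mulE : forall X Y Z, mul X (p Y Z) = p (br X Y) Z + p Y (br X Z).
Hypothesis murE : forall X Y Z, mur X (p Y Z) = - p (symbr br Y Z) X.

Lemma generated_mul_anchor X f u :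
  mul X (f *: u) = f *: mul X u + a X f *: u.
Proof.
elim/p_ind: u => [u v IHu IHv|Y Z].
  by rewrite scalerDr !mulD IHu IHv !scalerDr addrACA.
rewrite -pZl !mulE (pseudo_anchor hE) pDl !pZl scalerDr.
by rewrite addrAC.
Qed.

Lemma generated_mul_bilin :
  @bilin R (res_scalars iota E) (res_scalars iota M) (res_scalars iota M) mul.
Proof.
split=> [X r u v|u r X Y].
  rewrite mulD; congr (_ + _).
  change (mul X (iota r *: (u : M)) = iota r *: mul X u).
  elim/p_ind: (u : M) => [u1 u2 IH1 IH2|Y Z].
    by rewrite scalerDr !mulD IH1 IH2 scalerDr.
  by rewrite -pZl !mulE br_iotar !pZl scalerDr.
change (mul (iota r *: (X : E) + Y) u = iota r *: mul X u + mul Y u).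
elim/p_ind: (u : M) => [u1 u2 IH1 IH2|Z1 Z2].
  by rewrite !mulD IH1 IH2 scalerDr addrACA.
by rewrite !mulE !brDl !br_iotal pDl pDr pZl pZr scalerDr addrACA.
Qed.

Lemma generated_mur_bilin :
  @bilin R (res_scalars iota E) (res_scalars iota M) (res_scalars iota M) mur.
Proof.
split=> [X r u v|u r X Y].
  rewrite murD; congr (_ + _).
  change (mur X (iota r *: (u : M)) = iota r *: mur X u).
  elim/p_ind: (u : M) => [u1 u2 IH1 IH2|Y Z].
    by rewrite scalerDr !murD IH1 IH2 scalerDr.
  by rewrite -pZl !murE /symbr br_iotar br_iotal -scalerDr pZl scalerN.
change (mur (iota r *: (X : E) + Y) u = iota r *: mur X u + mur Y u).
elim/p_ind: (u : M) => [u1 u2 IH1 IH2|Z1 Z2].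
  by rewrite !murD IH1 IH2 scalerDr addrACA.
by rewrite !murE pDr pZr opprD scalerN.
Qed.

(** Only the first identity uses more than the derivation property of
    [br X]: with [s = symbr br Z1 Z2] it needs [symbr br s X = br X s], which is
    [br_symbr0]. *)
Lemma generated_module : is_pseudoalgebra_module br a mul mur.
Proof.
have mulN X u : mul X (- u) = - mul X u by exact: morphDN.
have murN X u : mur X (- u) = - mur X u by exact: morphDN.
split; last exact: generated_mul_anchor.
split; [exact: generated_mul_bilin | exact: generated_mur_bilin | | | ].
- move=> X Y u; change (mur (br X Y) u = mur Y (mur X u) + mul X (mur Y u) :> M).
  elim/p_ind: (u : M) => [u1 u2 IH1 IH2|Z1 Z2].
    by rewrite !(mulD, murD) IH1 IH2 addrACA.
  rewrite !murE murN mulN murE mulE opprK.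
  by rewrite [symbr br (symbr br _ _) _]/symbr br_symbr0 add0r opprD addNKr.
- move=> X Y u; change (mur (br X Y) u = mul X (mur Y u) - mur Y (mul X u) :> M).
  elim/p_ind: (u : M) => [u1 u2 IH1 IH2|Z1 Z2].
    by rewrite !(mulD, murD) IH1 IH2 opprD addrACA.
  rewrite !murE mulN !mulE murD !murE br_symbr (pDl Y) !opprD !opprK.
  by rewrite addrAC -opprD addNr add0r.
- move=> X Y u; change (mul (br X Y) u = mul X (mul Y u) - mul Y (mul X u) :> M).
  elim/p_ind: (u : M) => [u1 u2 IH1 IH2|Z1 Z2].
    by rewrite !(mulD, murD) IH1 IH2 opprD addrACA.
  apply/eqP; rewrite eq_sym subr_eq eq_sym; apply/eqP.
  rewrite !mulE !mulD !mulE !(brA X Y) pDl pDr.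
  by rewrite (AC (2*(2*2)) ((1*3*5)*(4*(2*6)))).
Qed.

End GeneratedModule.

(** * The quotient by the invariance relations *)

Section UniversalCourant.
Variables (R A : comPzRingType) (iota : {rmorphism R -> A}).
Variables (E : lmodType A) (br : E -> E -> E) (a : {linear E -> Der iota}).
Hypothesis hE : is_symmetric_leibniz_pseudoalgebra br a.
Implicit Types X Y Z : E.

Let hL : is_leibniz_pseudoalgebra br a := symmetric_pseudoalgebra hE.
Let hS : is_symmetric_bracket br := symmetric_pseudo_bracket hE.

Lemma symbrDr X : {morph symbr br X : Y Z / Y + Z}.
Proof. by move=> Y Z; rewrite /symbr (brDr hL) (brDl hL) addrACA. Qed.

Lemma symbrC : commutative (symbr br).
Proof. by move=> X Y; rewrite /symbr addrC. Qed.

Lemma symbr_balanced f X Y : symbr br X (f *: Y) = symbr br (f *: X) Y.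
Proof. by apply/eqP; rewrite -subr_eq0 (symmetric_scale hS). Qed.

Definition sym_contract : sym2 E -> E := sym2_lift (symbr br).

Lemma sym_contractD : {morph sym_contract : u v / u + v}.
Proof. exact: sym2_liftD symbrDr symbrC symbr_balanced. Qed.

Lemma sym_contractE X Y : sym_contract (X ⊙ Y) = symbr br X Y.
Proof. exact: sym2_liftE symbrDr symbrC symbr_balanced X Y. Qed.

Definition sym2_mul X : sym2 E -> sym2 E :=
  sym2_lift (fun Y Z => br X Y ⊙ Z + Y ⊙ br X Z).

Definition sym2_mur X (u : sym2 E) : sym2 E := - (sym_contract u ⊙ X).

Section MulAux.
Variable X : E.
Let b Y Z := br X Y ⊙ Z + Y ⊙ br X Z.

Let bD Y : {morph b Y : Z Z' / Z + Z'}.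
Proof. by move=> Z Z'; rewrite /b (brDr hL) !odotDr addrACA. Qed.

Let bC : commutative b.
Proof. by move=> Y Z; rewrite /b addrC [Y ⊙ _]odotC [_ ⊙ Z]odotC. Qed.

(** The anchor contributes [a X f *: (Y ⊙ Z)] whichever factor carries the
    scalar. *)
Let b_balanced f Y Z : b Y (f *: Z) = b (f *: Y) Z.
Proof.
rewrite /b !(pseudo_anchor hL) odotDr odotDl !odotZr !odotZl.
by rewrite addrA addrAC.
Qed.

Lemma sym2_mulD : {morph sym2_mul X : u v / u + v}.
Proof. exact: sym2_liftD bD bC b_balanced. Qed.

Lemma sym2_mulE Y Z : sym2_mul X (Y ⊙ Z) = br X Y ⊙ Z + Y ⊙ br X Z.
Proof. exact: sym2_liftE bD bC b_balanced Y Z. Qed.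

End MulAux.

Lemma sym2_murD X : {morph sym2_mur X : u v / u + v}.
Proof.
by move=> u v; rewrite /sym2_mur sym_contractD odotDl opprD.
Qed.

Lemma sym2_murE X Y Z : sym2_mur X (Y ⊙ Z) = - (symbr br Y Z ⊙ X).
Proof. by rewrite /sym2_mur sym_contractE. Qed.

Lemma sym2_module : is_pseudoalgebra_module br a sym2_mul sym2_mur.
Proof.
exact (generated_module hL (@odotDl A E) (@odotDr A E) (@odotZl A E)
  (@odotZr A E) (@sym2_ind A E) sym2_mulD sym2_murD sym2_mulE sym2_murE).
Qed.

Let inv X Y Z : sym2 E := br X Y ⊙ Z + Y ⊙ br X Z - X ⊙ symbr br Y Z.

(** The second symmetry axiom turns the contraction of a multiple of a relator
    into a left bracket with a symmetrized bracket, which is zero. *)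
Lemma sym_contract_Inv c u : Inv_set br u -> sym_contract (c *: u) = 0.
Proof.
case=> X [Y [Z ->]]; rewrite -/(symbr br Y Z).
(* The scalar goes to the factor where the symmetry axiom has it. *)
rewrite scalerBr scalerDr -odotZr -2!odotZl.
rewrite (morphDB sym_contractD) sym_contractD !sym_contractE.
have /eqP := symmetric_invariance hS c X Y Z.
rewrite -addrA -opprD subr_eq0 => /eqP <-.
by rewrite /symbr -/(symbr br Y Z) (br_symbr0 hL) addr0 subrr.
Qed.

(** The left action of [W] is a derivation for every operation occurring in
    [inv]. *)
Lemma sym2_mul_inv W X Y Z :
  sym2_mul W (inv X Y Z) =
    inv (br W X) Y Z + inv X (br W Y) Z + inv X Y (br W Z).
Proof.
rewrite /inv (morphDB (sym2_mulD W)) !sym2_mulD !sym2_mulE (br_symbr hL).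
rewrite (odotDr X) !(brA hL W X) (odotDl Z) (odotDr Y) !opprD.
by rewrite (AC (3*(1*2)*(1*2)) ((1*5*7)*(2*4*8)*(3*6*9))).
Qed.

Let RE_clsD : {morph RE_cls br : u v / u + v}.
Proof. exact: cls_additive. Qed.

Let RE_clsZ c u : RE_cls br (c *: u) = c *: RE_cls br u.
Proof. exact: clsZ. Qed.

Lemma RE_cls_inv X Y Z : RE_cls br (inv X Y Z) = 0.
Proof.
rewrite -(morphD0 RE_clsD).
by apply/clsP/asboolP => W _ PW; rewrite subr0; apply: PW; exists X, Y, Z.
Qed.


Lemma sym2_mul_Inv W c u :
  Inv_set br u -> RE_cls br (sym2_mul W (c *: u)) = 0.
Proof.
case=> X [Y [Z ->]]; rewrite -/(symbr br Y Z) -/(inv X Y Z).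
rewrite (pseudo_module_anchor sym2_module) sym2_mul_inv.
by rewrite RE_clsD !RE_clsZ 2!RE_clsD !RE_cls_inv !addr0 !scaler0 addr0.
Qed.

Lemma sym2_mur_Inv W c u :
  Inv_set br u -> RE_cls br (sym2_mur W (c *: u)) = 0.
Proof.
move=> /(sym_contract_Inv c) cu0.
by rewrite /sym2_mur cu0 (morphD0 (odotDl W)) oppr0 (morphD0 RE_clsD).
Qed.

Definition RE_mul X : RE br -> RE br :=
  quot_lift (fun u => RE_cls br (sym2_mul X u)).

Definition RE_mur X : RE br -> RE br :=
  quot_lift (fun u => RE_cls br (sym2_mur X u)).

Let RE_sym2_mulD X : {morph RE_cls br \o sym2_mul X : u v / u + v}.
Proof. by move=> u v /=; rewrite sym2_mulD RE_clsD. Qed.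

Let RE_sym2_murD X : {morph RE_cls br \o sym2_mur X : u v / u + v}.
Proof. by move=> u v /=; rewrite sym2_murD RE_clsD. Qed.

Lemma RE_mul_cls X u : RE_mul X (RE_cls br u) = RE_cls br (sym2_mul X u).
Proof. exact: quot_liftE (RE_sym2_mulD X) (@sym2_mul_Inv X) u. Qed.

Lemma RE_mur_cls X u : RE_mur X (RE_cls br u) = RE_cls br (sym2_mur X u).
Proof. exact: quot_liftE (RE_sym2_murD X) (@sym2_mur_Inv X) u. Qed.

Lemma RE_mulD X : {morph RE_mul X : u v / u + v}.
Proof. exact: quot_liftD (RE_sym2_mulD X) (@sym2_mul_Inv X). Qed.

Lemma RE_murD X : {morph RE_mur X : u v / u + v}.
Proof. exact: quot_liftD (RE_sym2_murD X) (@sym2_mur_Inv X). Qed.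

Let sp := univ_sp br.

Lemma univ_spC : commutative sp.
Proof. by move=> X Y; rewrite /sp /univ_sp odotC. Qed.

Lemma univ_sp_linearr X : linear (sp X).
Proof.
by move=> f Y Z; rewrite /sp /univ_sp odot_linearr RE_clsD RE_clsZ.
Qed.

Lemma univ_sp_bilin : bilin sp.
Proof.
split=> [|Y f X Z]; first exact: univ_sp_linearr.
by rewrite ![sp _ Y]univ_spC univ_sp_linearr.
Qed.

Lemma RE_mul_sp X Y Z : RE_mul X (sp Y Z) = sp (br X Y) Z + sp Y (br X Z).
Proof. by rewrite /sp /univ_sp RE_mul_cls sym2_mulE RE_clsD. Qed.

Lemma RE_mur_sp X Y Z : RE_mur X (sp Y Z) = - sp (symbr br Y Z) X.
Proof.
by rewrite /sp /univ_sp RE_mur_cls sym2_murE (morphDN RE_clsD).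
Qed.

Lemma RE_ind (Q : RE br -> Prop) :
  (forall u v, Q u -> Q v -> Q (u + v)) -> (forall X Y, Q (sp X Y)) ->
  forall u, Q u.
Proof.
move=> QD Qsp; apply: quotmod_ind; apply: sym2_ind => // u v Qu Qv.
by rewrite cls_additive; apply: QD.
Qed.

Lemma univ_sp_invariant X Y Z :
  sp (br X Y) Z + sp Y (br X Z) = sp (symbr br Y Z) X.
Proof.
apply/eqP; rewrite -subr_eq0 -[sp _ X]univ_spC /sp /univ_sp; apply/eqP.
by rewrite -(RE_cls_inv X Y Z) /inv (morphDB RE_clsD) RE_clsD.
Qed.

Lemma RE_module : is_pseudoalgebra_module br a RE_mul RE_mur.
Proof.
have spDr X : {morph sp X : Y Z / Y + Z}.
  by move=> Y Z; have := univ_sp_linearr X 1 Y Z; rewrite !scale1r.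
have spZr f X Y : sp X (f *: Y) = f *: sp X Y.
  by have := univ_sp_linearr X f Y 0; rewrite /= (morphD0 (spDr X)) !addr0.
have spDl Y : {morph sp^~ Y : X Z / X + Z}.
  by move=> X Z; rewrite ![sp _ Y]univ_spC spDr.
have spZl f X Y : sp (f *: X) Y = f *: sp X Y by rewrite ![sp _ Y]univ_spC.
exact (generated_module hL spDl spDr spZl spZr RE_ind RE_mulD RE_murD
  RE_mul_sp RE_mur_sp).
Qed.

Lemma RE_courant : is_generalized_courant br (univ_sp br) a RE_mul RE_mur.
Proof.
split=> //; split=> //.
- exact: RE_module.
- exact: univ_spC.
- exact: univ_sp_bilin.
- exact: RE_mul_sp.
- by move=> X Y Z; rewrite RE_mur_sp opprK.
- exact: univ_sp_invariant.
Qed.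

End UniversalCourant.

Theorem theorem1 (R A : comPzRingType) (iota : {rmorphism R -> A})
  (E : lmodType A) (br : E -> E -> E) (a : {linear E -> Der iota})
  (hE : is_symmetric_leibniz_pseudoalgebra br a) :
  exists (mul mur : E -> sym2 E -> sym2 E) (mulq murq : E -> RE br -> RE br),
    [/\ @bilin R (res_scalars iota E) (res_scalars iota (sym2 E))
          (res_scalars iota (sym2 E)) mul,
        @bilin R (res_scalars iota E) (res_scalars iota (sym2 E))
          (res_scalars iota (sym2 E)) mur,
        forall X Y1 Y2, mul X (Y1 ⊙ Y2) = br X Y1 ⊙ Y2 + Y1 ⊙ br X Y2 &
        forall X Y1 Y2, - mur X (Y1 ⊙ Y2) = symbr br Y1 Y2 ⊙ X] /\
    [/\ forall X u, mulq X (RE_cls br u) = RE_cls br (mul X u),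
        forall X u, murq X (RE_cls br u) = RE_cls br (mur X u),
        is_pseudoalgebra_module br a mulq murq &
        is_generalized_courant br (univ_sp br) a mulq murq].
Proof.
have hmod := pseudo_module_leibniz (sym2_module hE).
exists (sym2_mul br), (sym2_mur br), (@RE_mul A E br), (@RE_mur A E br).
split; split.
- exact: lmul_bilinear hmod.
- exact: rmul_bilinear hmod.
- exact: sym2_mulE hE.
- by move=> X Y1 Y2; rewrite (sym2_murE hE) opprK.
- exact: RE_mul_cls hE.
- exact: RE_mur_cls hE.
- exact: RE_module hE.
- exact: RE_courant hE.
Qed.
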